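(* Let $L,\lambda,\mu>0$ and $0<\varepsilon<1$. (1) The optimal number of communication rounds of RFRec to obtain $O(\varepsilon)$-accuracy, i.e. the minimum of $2\cdot\frac{1}{\alpha\mu}\log\frac1\varepsilon$ over $0<\alpha\le\frac{1}{L+\lambda}$, is $$2\,\frac{L+\lambda}{\mu}\log\frac1\varepsilon,$$ attained by selecting $\alpha=\frac{1}{L+\lambda}$. (2) The optimal expected number of communication rounds of RFRecF to obtain $O(\varepsilon)$-accuracy, i.e. the minimum of $2p(1-p)\cdot\frac{1}{\alpha\mu}\log\frac1\varepsilon$ over $p\in(0,1)$ with $\alpha$ chosen as $\alpha=\frac{1}{2\mathcal{L}}$, $\mathcal{L}=\max\{\frac{L}{1-p},\frac{\lambda}{p}\}$, is $$\frac{4\lambda}{L+\lambda}\,\frac{L}{\mu}\log\frac1\varepsilon,$$ attained by selecting $p=\frac{\lambda}{L+\lambda}$ and $\alpha=\frac{1}{2(L+\lambda)}$.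
   Context: Setting: a function $F=f+\lambda\psi$, where $f(x)=\sum_{i=1}^n f_i(x_i)$ with $x_i=(u_i,V_{(i)})\in\mathbb{R}^d\times\mathbb{R}^{d\times m}$, $f_i(x_i)=\|R_i-u_i^TV_{(i)}\|^2+\lambda_u\|u_i\|^2$ ($R_i\in\mathbb{R}^{1\times m}$ fixed), and $\psi(x)=\frac12\sum_i\|V_{(i)}-\bar V\|^2$, $\bar V=\frac1n\sum_iV_{(i)}$. All parameters are uniformly bounded, $\|u_i\|\le M_u$, $\|V_{(i)}\|\le M_v$, $\|R_i\|\le M_r$. $L$ is a smoothness constant of every $f_i$ and $\mu$ a strong convexity constant of $F$ on the bounded parameter domain. RFRec is gradient descent $x^{k+1}=x^k-\alpha\nabla F(x^k)$, with admissible learning rates $0<\alpha\le\frac1{L+\lambda}$. RFRecF is $x^{k+1}=x^k-\alpha G(x^k)$, where $G(x)=\frac{\nabla f(x)}{1-p}$ with probability $1-p$ and $G(x)=\frac{\lambda\nabla\psi(x)}{p}$ with probability $p$, with admissible learning rates $0<\alpha\le\frac1{2\mathcal{L}}$, $\mathcal{L}=\max\{\frac{L}{1-p},\frac\lambda p\}$. The error bounds contract the initial squared distance to the optimum by $(1-\alpha\mu)^k$ after $k$ iterations, and accordingly the number of iterations to obtain $O(\varepsilon)$-accuracy is counted as $T=\frac{1}{\alpha\mu}\log\frac1\varepsilon$ for both methods (for RFRecF the residual variance term of the bound is disregarded in this count). A communication round is a round in which clients send information to the server or the server sends information to clients. RFRec uses $2T$ communication rounds in $T$ iterations; RFRecF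 uses $2p(1-p)T$ communication rounds in expectation in $T$ iterations. *)

(* Defs.v *)
From Stdlib Require Import Reals.
Open Scope R_scope.

Definition is_minimum_at {X : Type} (P : X -> Prop) (f : X -> R) (x : X) (m : R)
  : Prop :=
  P x /\ f x = m /\ forall y : X, P y -> m <= f y.

(* The iteration count T for O(eps)-accuracy: the solution of
   exp (- alpha * mu * T) = eps, coming from the error factor (1 - alpha mu)^k.
   As usual in such complexity counts it is a real number, not rounded up. *)
Definition iterations (mu eps alpha : R) : R :=
  1 / (alpha * mu) * ln (1 / eps).

Definition RFRec_admissible (L lambda alpha : R) : Prop :=
  0 < alpha <= 1 / (L + lambda).

(* Each gradient step on F costs one upload and one download. *)
Definition RFRec_rounds (mu eps alpha : R) : R :=
  2 * iterations mu eps alpha.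

(* Smoothness constant of the stochastic gradient that equals
   grad f / (1 - p) with probability 1 - p and lambda grad psi / p with
   probability p. *)
Definition RFRecF_smoothness (L lambda p : R) : R :=
  Rmax (L / (1 - p)) (lambda / p).

(* A setting is a pair (p, alpha); the learning rate is the largest one
   allowed for the given p. *)
Definition RFRecF_setting (L lambda : R) (s : R * R) : Prop :=
  let (p, alpha) := s in
  0 < p < 1 /\ alpha = 1 / (2 * RFRecF_smoothness L lambda p).

(* Expected number of rounds: a communication is triggered when the coin
   changes between a local step and an aggregation step. *)
Definition RFRecF_expected_rounds (mu eps : R) (s : R * R) : R :=
  let (p, alpha) := s in
  2 * p * (1 - p) * iterations mu eps alpha.

(* Main.v *)
(** With the largest learning rate, the expected number of rounds of RFRecF is
    [4 / mu * ln (1 / eps)] times [max (p L) ((1 - p) lambda)].  The weights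
    [lambda] and [L] combine the two arguments of the maximum into the constant
    [L lambda], so the maximum is at least [L lambda / (L + lambda)], with
    equality exactly when both arguments agree, i.e. at
    [p = lambda / (L + lambda)]. *)
Require Import Defs.
From Stdlib Require Import Reals Lra.
Open Scope R_scope.

Lemma ln_inv_pos (eps : R) : 0 < eps < 1 -> 0 < ln (1 / eps).
Proof.
  intros [h0 h1].
  rewrite <- ln_1; apply ln_increasing; [lra|].
  unfold Rdiv; rewrite Rmult_1_l, <- Rinv_1.
  apply Rinv_lt_contravar; lra.
Qed.

(** Every learning rate that matters here is the reciprocal of a smoothness bound [M], so the count
    becomes linear in [M]. *)
Lemma iterations_inv (mu eps M : R) :
  0 < M -> 0 < mu -> iterations mu eps (1 / M) = M / mu * ln (1 / eps).
Proof.
  intros hM hmu; unfold iterations.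
  replace (1 / (1 / M * mu)) with (M / mu) by (field; lra).
  reflexivity.
Qed.

Lemma iterations_antitone (mu eps a b : R) :
  0 < mu -> 0 < eps < 1 -> 0 < a <= b ->
  iterations mu eps b <= iterations mu eps a.
Proof.
  (* Occurrences 1 and 3 are the quotients in the learning rates; [1 / eps] inside the logarithms
     stays folded for [ln_inv_pos]. *)
  intros hmu heps [ha hab]; unfold iterations, Rdiv at 1 3.
  apply Rmult_le_compat_r; [apply Rlt_le, ln_inv_pos, heps|].
  rewrite !Rmult_1_l.
  apply Rinv_le_contravar.
  - apply Rmult_lt_0_compat; assumption.
  - apply Rmult_le_compat_r; lra.
Qed.

Lemma RFRecF_smoothness_pos (L lambda p : R) :
  0 < L -> 0 < p < 1 -> 0 < RFRecF_smoothness L lambda p.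
Proof.
  intros hL hp; unfold RFRecF_smoothness.
  apply Rlt_le_trans with (L / (1 - p)); [|apply Rmax_l].
  apply Rdiv_lt_0_compat; lra.
Qed.

(** A nonnegative factor passes into the maximum, where it cancels each denominator. *)
Lemma RFRecF_smoothness_scaled (L lambda p : R) :
  0 < p < 1 ->
  p * (1 - p) * RFRecF_smoothness L lambda p = Rmax (p * L) ((1 - p) * lambda).
Proof.
  intros hp; unfold RFRecF_smoothness.
  rewrite <- RmaxRmult by (apply Rmult_le_pos; lra).
  f_equal; field; lra.
Qed.

Lemma RFRecF_smoothness_balanced (L lambda : R) :
  0 < L -> 0 < lambda ->
  RFRecF_smoothness L lambda (lambda / (L + lambda)) = L + lambda.
Proof.
  intros hL hl; unfold RFRecF_smoothness.
  replace (L / (1 - lambda / (L + lambda))) with (L + lambda) by (field; lra).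
  replace (lambda / (lambda / (L + lambda))) with (L + lambda) by (field; lra).
  apply Rmax_left; lra.
Qed.

Lemma Rmax_balance_lower_bound (L lambda p : R) :
  0 < L -> 0 < lambda ->
  L * lambda / (L + lambda) <= Rmax (p * L) ((1 - p) * lambda).
Proof.
  intros hL hl.
  apply Rmult_le_reg_r with (L + lambda); [lra|].
  (* In this weighted sum the terms in [p] cancel, leaving [L * lambda]; each summand is then
     bounded by its weight times the maximum. *)
  replace (L * lambda / (L + lambda) * (L + lambda))
    with (lambda * (p * L) + L * ((1 - p) * lambda)) by (field; lra).
  rewrite Rmult_plus_distr_l, Rplus_comm, !(Rmult_comm (Rmax _ _)).
  apply Rplus_le_compat; apply Rmult_le_compat_l;
    solve [lra | apply Rmax_l | apply Rmax_r].
Qed.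

(** The 4 joins the 2 of the round count with the 2 in the learning rate. *)
Lemma RFRecF_expected_rounds_setting (L lambda mu eps p : R) :
  0 < L -> 0 < mu -> 0 < p < 1 ->
  RFRecF_expected_rounds mu eps (p, 1 / (2 * RFRecF_smoothness L lambda p))
  = 4 / mu * ln (1 / eps) * Rmax (p * L) ((1 - p) * lambda).
Proof.
  intros hL hmu hp; unfold RFRecF_expected_rounds.
  pose proof (RFRecF_smoothness_pos L lambda p hL hp).
  rewrite iterations_inv, <- RFRecF_smoothness_scaled by lra.
  field; lra.
Qed.

Theorem corollary3p10 (L lambda mu eps : R)
  (hL : 0 < L) (hlambda : 0 < lambda) (hmu : 0 < mu) (heps : 0 < eps < 1) :
  is_minimum_at (RFRec_admissible L lambda) (RFRec_rounds mu eps)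
    (1 / (L + lambda))
    (2 * ((L + lambda) / mu) * ln (1 / eps))
  /\
  is_minimum_at (RFRecF_setting L lambda) (RFRecF_expected_rounds mu eps)
    (lambda / (L + lambda), 1 / (2 * (L + lambda)))
    (4 * lambda / (L + lambda) * (L / mu) * ln (1 / eps)).
Proof.
  pose proof (ln_inv_pos eps heps) as hln.
  split.
  - assert (hmin : RFRec_rounds mu eps (1 / (L + lambda))
                   = 2 * ((L + lambda) / mu) * ln (1 / eps)).
    { unfold RFRec_rounds; rewrite iterations_inv by lra; ring. }
    split; [|split; [exact hmin|]].
    + split; [apply Rdiv_lt_0_compat|]; lra.
    (* Larger rates need fewer iterations, so the upper end of the admissible interval is
       optimal. *)
    + intros alpha halpha; rewrite <- hmin; unfold RFRec_rounds.
      apply Rmult_le_compat_l; [lra|].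
      apply iterations_antitone; assumption.
  - split; [|split].
    + split; [split|].
      * apply Rdiv_lt_0_compat; lra.
      * apply Rmult_lt_reg_r with (L + lambda); [lra|].
        unfold Rdiv; rewrite Rmult_assoc, Rinv_l; lra.
      * rewrite RFRecF_smoothness_balanced by assumption; reflexivity.
    + unfold RFRecF_expected_rounds.
      rewrite iterations_inv by lra.
      field; lra.
    (* The setting determines [alpha] from [p], so only [p] remains to be optimized. *)
    + intros [p alpha] [hp ->].
      rewrite RFRecF_expected_rounds_setting by assumption.
      replace (4 * lambda / (L + lambda) * (L / mu) * ln (1 / eps))
        with (4 / mu * ln (1 / eps) * (L * lambda / (L + lambda)))
        by (field; lra).
      apply Rmult_le_compat_l.
      * apply Rlt_le, Rmult_lt_0_compat; [apply Rdiv_lt_0_compat; lra|exact hln].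
      * apply Rmax_balance_lower_bound; assumption.
Qed.
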